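(* Let $X_1=X_2=\mathbb{R}^d$, let $\mu_1=\mu_2$ be the uniform distribution on $[0,1]^d$ and $c(x,y)=\sum_{i=1}^d|x_i-y_i|$. (i) Let $f(x)=x\log(x)$. Then for all $\varepsilon>0$, $$\mathsf{OT}_{f,\varepsilon}-\mathsf{OT}\ge d\,\varepsilon\log(1/\varepsilon)-(2^d-1)\varepsilon .$$ In particular, the leading term matches the one in the upper bound $\beta\varepsilon\log(1/\varepsilon)+O(\varepsilon)$ with $\beta=d$. (ii) Let $f(x)=\frac1\rho(x^\rho-1)$ for some $\rho>1$. Then $$\mathsf{OT}_{f,\varepsilon}-\mathsf{OT}\ge K\varepsilon^{\frac{1}{(\rho-1)d+1}}+O(\varepsilon)\quad\text{as }\varepsilon\to0$$ for a constant $K>0$. In particular, the leading term has the same exponent as the upper bound of the form $K'\varepsilon^{\frac{1}{(\rho-1)\beta+1}}$ with $\beta=d$.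
   Context: $\Pi(\mu_1,\mu_2)$ is the set of couplings. $D_f(\mu,\nu)=\int f(\frac{d\mu}{d\nu})\,d\nu$ if $\mu\ll\nu$ and $D_f(\mu,\nu)=\infty$ otherwise (with $0\log0=0$). For $\varepsilon>0$, $$\mathsf{OT}=\inf_{\pi\in\Pi(\mu_1,\mu_2)}\int c\,d\pi,\qquad \mathsf{OT}_{f,\varepsilon}=\inf_{\pi\in\Pi(\mu_1,\mu_2)}\int c\,d\pi+\varepsilon D_f(\pi,\mu_1\otimes\mu_2).$$ The upper bounds mentioned for comparison are those known for Lipschitz-type costs, where $1/\beta$ is the exponent $\alpha$ in the quantization rate $W_p(\mu^n,\mu_2)\le Cn^{-\alpha}$ by measures $\mu^n$ supported on at most $n$ points; for $\mu_2$ uniform on $[0,1]^d$ one has $\alpha=1/d$. The mathematical content to be proved is the two displayed lower bounds. *)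

(* Defs.v *)
From HB Require Import structures.
From mathcomp Require Import all_boot all_order all_algebra.
From mathcomp Require Import all_classical all_reals all_analysis.

Set Implicit Arguments.
Unset Strict Implicit.
Unset Printing Implicit Defensive.

Import Order.TTheory GRing.Theory Num.Theory.
Import numFieldNormedType.Exports.

Local Open Scope classical_set_scope.
Local Open Scope ring_scope.

Section optimal_transport.
Context d1 d2 (T1 : measurableType d1) (T2 : measurableType d2).
Context (R : realType).
Variables (mu1 : probability T1 R) (mu2 : probability T2 R).

Definition couplings : set (probability (T1 * T2)%type R) :=
  [set pi | (forall A, measurable A -> pi (A `*` setT) = mu1 A) /\
            (forall B, measurable B -> pi (setT `*` B) = mu2 B)].

Definition OT (c : T1 * T2 -> R) : \bar R :=
  ereal_inf [set (\int[pi]_z (c z)%:E)%E | pi in couplings].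

End optimal_transport.

Section f_divergence.
Context d (T : measurableType d) (R : realType).
Local Open Scope charge_scope.

(* When mu `<< nu, 'd mu '/d nu is finite everywhere, so [fine] loses nothing. *)
Definition fdiv (f : R -> R) (mu nu : probability T R) : \bar R :=
  if `[< mu `<< nu >]
  then (\int[nu]_z (f (fine (('d (charge_of_finite_measure mu) '/d nu) z)))%:E)%E
  else +oo%E.

End f_divergence.

Definition regularized_OT d1 d2 (T1 : measurableType d1)
    (T2 : measurableType d2) (R : realType)
    (mu1 : probability T1 R) (mu2 : probability T2 R) (c : T1 * T2 -> R)
    (f : R -> R) (e : R) : \bar R :=
  ereal_inf [set (\int[pi]_z (c z)%:E + e%:E * fdiv f pi (mu1 \x mu2))%E
            | pi in couplings mu1 mu2].

Section uniform_cube.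
Context (R : realType).
Local Notation RR := (measurableTypeR R).

Definition tuple_cons n (x : RR * n.-tuple RR) : n.+1.-tuple RR :=
  [tuple of x.1 :: x.2].

Lemma measurable_tuple_cons n : measurable_fun setT (@tuple_cons n).
Proof. exact: measurable_cons. Qed.

HB.instance Definition _ n :=
  isMeasurableFun.Build _ _ _ _ (@tuple_cons n) (@measurable_tuple_cons n).

(* The law of n independent uniform variables on [0, 1], i.e. the restriction of
   n-dimensional Lebesgue measure to the unit cube; see [uniform_cube_box]. *)
Fixpoint uniform_cube (n : nat) : probability (n.-tuple RR) R :=
  match n with
  | 0 => \d_[tuple]
  | m.+1 => distribution (uniform_prob (@ltr01 R) \x uniform_cube m)%E
              (@tuple_cons m)
  end.

Definition l1_cost n (z : n.-tuple RR * n.-tuple RR) : R :=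
  \sum_(i < n) `|tnth z.1 i - tnth z.2 i|.

End uniform_cube.

Lemma uniform_prob_itv (R : realType) (a b : R) :
  0 <= a -> a <= b -> b <= 1 ->
  uniform_prob (@ltr01 R) [set x | a <= x <= b] = (b - a)%:E.
Proof.
move=> a0 ab b1; rewrite /uniform_prob (_ : [set x | _] = `[a, b]%classic); last first.
  by apply/seteqP; split => x /=; rewrite in_itv.
rewrite (eq_integral (cst 1%:E)); last first.
  move=> x; rewrite inE/= in_itv/= => /andP[ax xb].
  by rewrite /uniform_pdf (le_trans a0 ax) (le_trans xb b1) /= subr0 invr1.
rewrite integral_cst//= mul1e lebesgue_measure_itv/= lte_fin.
case: ltP => // ba; have -> : a = b by apply/eqP; rewrite eq_le ab ba.
by rewrite subrr.
Qed.

Lemma uniform_cube_box (R : realType) n (a b : 'I_n -> R) :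
  (forall i, [/\ 0 <= a i, a i <= b i & b i <= 1]) ->
  uniform_cube R n [set x | forall i, a i <= tnth x i <= b i] =
  (\prod_(i < n) (b i - a i))%:E.
Proof.
elim: n a b => [|n IHn] a b ab.
  by rewrite big_ord0 /= diracE mem_set//= => -[].
rewrite big_ord_recl EFinM -(IHn (a \o lift ord0) (b \o lift ord0)); last first.
  by move=> i; exact: ab.
have [a0 ab0 b0] := ab ord0.
rewrite -uniform_prob_itv// /= /distribution /pushforward.
rewrite (_ : _ @^-1` _ = [set x | a ord0 <= x <= b ord0] `*`
  [set x | forall i, a (lift ord0 i) <= tnth x i <= b (lift ord0 i)]); last first.
  apply/seteqP; split => [[x t] /= h|[x t] /= [h1 h2] i].
    by split => [|i]; [have := h ord0|have := h (lift ord0 i)]; rewrite ?tnthS.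
  by case: (unliftP ord0 i) => [j ->|->]; rewrite ?tnthS.
rewrite product_measure1E//.
  rewrite (_ : [set x | _] = `[a ord0, b ord0]%classic); first exact: measurable_itv.
  by apply/seteqP; split => x /=; rewrite in_itv.
rewrite (_ : [set x | _] = \bigcap_(i in [set: 'I_n])
   ((fun x => tnth x i) @^-1` `[a (lift ord0 i), b (lift ord0 i)]%classic)).
  apply: fin_bigcap_measurable => // i _; rewrite -[X in measurable X]setTI.
  exact: measurable_tnth.
apply/seteqP; split => x /= h i.
  by move=> _; rewrite /= in_itv; exact: h.
by have := h i I; rewrite /= in_itv.
Qed.

(* Main.v *)
(** The cost of the diagonal coupling vanishes, so [OT = 0] and only the regularized
    problem has to be bounded below.  If [w] is the density of a coupling with respect
    to [mu \x mu] and [t] is a function of [z = (x, y)], Fenchel-Young gives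
    [f w >= t w - f^* t]; taking [t = (a - c) / e] and integrating yields
    [\int c w + e f(w) >= a - e \int f^*((a - c) / e) d(mu \x mu)].
    For [f x = x ln x] the last integral factors over the coordinates, each factor being
    at most [2 e], and [a = e (1 + d ln (1 / e))] gives (i).
    For [f x = (x^rho - 1) / rho] it is at most a multiple of the mass of [{c <= a}],
    up to an additive constant; this set lies in a product of strips [{|x_i - y_i| <= a}]
    of mass at most [2 a] each, and [a = e^s / 2] with [s = 1 / ((rho - 1) d + 1)]
    balances the two terms. *)
From HB Require Import structures.
Require Import Defs.
From mathcomp Require Import all_boot all_order all_algebra.
From mathcomp Require Import all_classical all_reals all_analysis.
From mathcomp Require Import measurable_realfun ring lra.

Import Order.TTheory GRing.Theory Num.Theory.
Import numFieldNormedType.Exports.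

Local Open Scope classical_set_scope.
Local Open Scope ring_scope.

(** * Weak duality for a cost penalized by a divergence *)

Lemma probability_integral_cst d (T : measurableType d) (R : realType)
  (P : probability T R) (r : R) : (\int[P]_z r%:E = r%:E)%E.
Proof.
rewrite integral_cst// [X in (_ * X)%E](_ : _ = 1)%E ?mule1//.
exact: (probability_setT P).
Qed.

(** Integrate the pointwise inequality at [w] equal to the density of [pi], which has [nu]-integral
    1. Here [h] stands for an upper bound of the conjugate term [e * f^*((a - c) / e)]. Without
    absolute continuity the divergence is [+oo]. *)
Lemma fdiv_duality d (T : measurableType d) (R : realType)
    (pi nu : probability T R) (c h : T -> R) (f : R -> R) (M a H e : R) :
  measurable_fun setT c -> (forall z, 0 <= c z) ->
  measurable_fun setT h -> (forall z, 0 <= h z) ->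
  measurable_fun setT f -> (forall w, 0 <= w -> - M <= f w) -> 0 < e ->
  (forall z w, 0 <= w -> a * w - h z <= c z * w + e * f w) ->
  (\int[nu]_z (h z)%:E <= H%:E)%E ->
  ((a - H)%:E <= \int[pi]_z (c z)%:E + e%:E * fdiv f pi nu)%E.
Proof.
move=> mc c0 mh h0 mf fM e0 dual hH; rewrite /fdiv.
have C0 : (0 <= \int[pi]_z (c z)%:E)%E.
  by apply: integral_ge0 => z _; rewrite lee_fin.
case: asboolP => [pinu|_]; last first.
  by rewrite gt0_muley ?lte_fin// addey ?leey// gt_eqF// (lt_le_trans _ C0).
(* A version of the density that is nonnegative everywhere, whereas ['d pi '/d nu] is
   only nonnegative almost everywhere. *)
pose g z := fine (Radon_Nikodym_SigmaFinite.f pi nu z).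
have gE z : Radon_Nikodym_SigmaFinite.f pi nu z = (g z)%:E.
  by rewrite fineK//; exact: Radon_Nikodym_SigmaFinite.f_fin_num.
have g0 z : 0 <= g z by rewrite -lee_fin -gE; exact: Radon_Nikodym_SigmaFinite.f_ge0.
have mg : measurable_fun setT g.
  apply/measurable_EFinP.
  rewrite [X in measurable_fun _ X](_ : _ = Radon_Nikodym_SigmaFinite.f pi nu).
    exact: measurable_int (Radon_Nikodym_SigmaFinite.f_integrable pinu).
  by apply/funext => z; rewrite /= gE.
have g1 : (\int[nu]_z (g z)%:E = 1)%E.
  under eq_integral do rewrite -gE.
  by rewrite -Radon_Nikodym_SigmaFinite.f_integral//; exact: (probability_setT pi).
have -> : (\int[pi]_z (c z)%:E = \int[nu]_z (c z * g z)%:E)%E.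
  rewrite -(Radon_Nikodym_SigmaFinite.change_of_variables pinu)//.
  - by apply: eq_integral => z _; rewrite gE EFinM.
  - exact/measurable_EFinP.
have mw : measurable_fun setT (fine \o Radon_Nikodym (charge_of_finite_measure pi) nu).
  exact: measurableT_comp.
have -> : (\int[nu]_z (f (fine (Radon_Nikodym (charge_of_finite_measure pi) nu z)))%:E
   = \int[nu]_z (f (g z))%:E)%E.
  apply: ae_eq_integral => //.
  - exact/measurable_EFinP/(measurableT_comp mf mw).
  - exact/measurable_EFinP/measurableT_comp.
  - have := ae_eq_Radon_Nikodym_SigmaFinite pinu measurableT.
    by apply: filterS => z /= /(_ I) <-.
have M0 : 0 <= Num.max M 0 by rewrite le_max lexx orbT.
rewrite [X in (_ + _ * X)%E]integralE.
set P := (\int[nu]_z _^\+ _)%E; set N := (\int[nu]_z _^\- _)%E.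
have mfg : measurable_fun setT (fun z => (f (g z))%:E).
  exact/measurable_EFinP/measurableT_comp.
have P0 : (0 <= P)%E by apply: integral_ge0 => z _; exact: funepos_ge0.
have N0 : (0 <= N)%E by apply: integral_ge0 => z _; exact: funeneg_ge0.
(* The lower bound [- M] on [f] makes the negative part bounded, so [P - N] is never of the form
   [oo - oo]. The maximum with 0 covers a negative [M]. *)
have Nfin : N \is a fin_num.
  rewrite ge0_fin_numE//; apply: (@le_lt_trans _ _ (Num.max M 0)%:E); last exact: ltry.
  rewrite [leRHS](_ : _ = \int[nu]_z (Num.max M 0)%:E)%E; last first.
    by rewrite probability_integral_cst.
  apply: ge0_le_integral => //.
  - exact: measurable_funeneg.
  - move=> z _; rewrite funenegE -EFin_max lee_fin.
    by rewrite ge_max !le_max lexx orbT andbT lerNl fM.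
(* Adding [`|a| g] keeps all terms nonnegative, so that no integrability is needed. *)
have key : ((`|a| + a)%:E * \int[nu]_z (g z)%:E + e%:E * N <=
  \int[nu]_z (c z * g z)%:E + e%:E * P + \int[nu]_z (h z)%:E +
  `|a|%:E * \int[nu]_z (g z)%:E)%E.
  have a0 : 0 <= `|a| + a by have := ler_norm (- a); rewrite normrN; lra.
  have me F : measurable_fun setT F -> measurable_fun setT (fun z : T => (F z)%:E).
    by move=> ?; exact/measurable_EFinP.
  have mcg : measurable_fun setT (fun z => (c z * g z)%:E) by apply/me/measurable_funM.
  have mP : measurable_fun setT ((fun z => (f (g z))%:E)^\+)%E.
    exact: measurable_funepos.
  have mN : measurable_fun setT ((fun z => (f (g z))%:E)^\-)%E.
    exact: measurable_funeneg.
  have gg z : (0 <= (g z)%:E)%E by rewrite lee_fin.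
  have cg z : (0 <= (c z * g z)%:E)%E by rewrite lee_fin mulr_ge0.
  have hh z : (0 <= (h z)%:E)%E by rewrite lee_fin.
  have PP := funepos_ge0 (fun z => (f (g z))%:E).
  have NN := funeneg_ge0 (fun z => (f (g z))%:E).
  rewrite -!ge0_integralZl ?lee_fin ?(ltW e0)//; try exact: me.
  have e00 := ltW e0.
  have na := normr_ge0 a.
  have mm r F : measurable_fun setT F ->
      measurable_fun setT (fun z : T => r%:E * F z)%E.
    by move=> ?; exact: emeasurable_funM.
  rewrite -!ge0_integralD//; try by
    [ move=> z _; do ?[done | apply: adde_ge0 | apply: mule_ge0]
    | do ?apply: emeasurable_funD; rewrite //; try apply: mm => //; apply: me].
  apply: ge0_le_integral => //; try by
    [ move=> z _; do ?[done | apply: adde_ge0 | apply: mule_ge0]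
    | do ?apply: emeasurable_funD; rewrite //; try apply: mm => //; apply: me].
  move=> z _; rewrite funeposE funenegE -!EFin_max -!EFinM -!EFinD lee_fin.
  have := dual z _ (g0 z); set r := f (g z).
  have [r0|/ltW r0] := leP 0 r.
    by rewrite (max_idPr _) ?oppr_le0//; lra.
  by rewrite (max_idPl _) ?oppr_ge0//; lra.
move: key; rewrite g1 !mule1 => key.
have {}key : ((`|a| + a)%:E + e%:E * N <=
   \int[nu]_z (c z * g z)%:E + e%:E * P + H%:E + `|a|%:E)%E.
  by apply: (le_trans key); rewrite leeD2r// leeD2l.
move: P0 C0 key; rewrite -(fineK Nfin); set n := fine N.
have : (0 <= \int[nu]_z (c z * g z)%:E)%E.
  by apply: integral_ge0 => z _; rewrite lee_fin mulr_ge0.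
(* An infinite cost or an infinite [P] makes the right-hand side [+oo]; otherwise [key] is an
   inequality of reals in which [|a|] cancels. *)
case: (\int[nu]_z (c z * g z)%:E)%E => [C| |]//; last first.
  move=> _ P0 _ _; rewrite addye ?leey//.
  by case: P P0 => [p| |]// _; rewrite addye// gt0_muley ?lte_fin.
move=> _; case: P => [p| |]// _ _.
  by rewrite -EFinB -!EFinM -!EFinD !lee_fin; lra.
by move=> _; rewrite addye// gt0_muley ?lte_fin// addey ?leey.
Qed.

(** * Product kernels on the cube *)

Section cube_integrals.
Context (R : realType).
Local Notation RR := (measurableTypeR R).
Implicit Types (phi : R -> R) (n : nat).

Lemma measurable_prod_tnth_sub phi n : measurable_fun setT phi ->
  measurable_fun setT (fun z : n.-tuple RR * n.-tuple RR =>
    \prod_(i < n) phi (tnth z.1 i - tnth z.2 i)).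
Proof.
move=> mphi; apply: measurable_prod => i _.
apply: measurableT_comp => //; apply: measurable_funB.
- exact: (measurableT_comp (measurable_tnth i) measurable_fst).
- exact: (measurableT_comp (measurable_tnth i) measurable_snd).
Qed.

(** By Tonelli each coordinate splits off a factor at most [M]. The bound is uniform in the shift
    [t], so the induction runs over all [x]. *)
Lemma uniform_cube_prod_le phi (M : R) n (x : n.-tuple RR) :
  measurable_fun setT phi -> (forall t, 0 <= phi t) ->
  (forall t, \int[uniform_prob (@ltr01 R)]_u (phi (t - u))%:E <= M%:E)%E ->
  (\int[uniform_cube R n]_y (\prod_(i < n) phi (tnth x i - tnth y i))%:E
    <= (M ^+ n)%:E)%E.
Proof.
move=> mphi phi0 phiM.
have M0 : 0 <= M.
  rewrite -lee_fin; apply: le_trans (phiM 0).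
  by apply: integral_ge0 => u _; rewrite lee_fin.
elim: n x => [x|n IHn x].
  under eq_integral do rewrite big_ord0.
  by rewrite expr0 probability_integral_cst.
have prod0 m (s t : m.-tuple RR) : 0 <= \prod_(i < m) phi (tnth s i - tnth t i).
  by apply: prodr_ge0.
have mprod m (s : m.-tuple RR) :
    measurable_fun setT (fun t : m.-tuple RR => \prod_(i < m) phi (tnth s i - tnth t i)).
  apply: measurable_prod => i _; apply: measurableT_comp => //.
  by apply: measurable_funB => //; exact: measurable_tnth.
rewrite [uniform_cube R n.+1]/= ge0_integral_distribution//=; last 2 first.
- by apply/measurable_EFinP; exact: (mprod n.+1 x).
- by move=> y; rewrite lee_fin; exact: prod0.
pose F (z : RR * n.-tuple RR) :=
  (\prod_(i < n.+1) phi (tnth x i - tnth (tuple_cons z) i))%:E.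
have F0 z : (0 <= F z)%E by rewrite lee_fin; exact: prod0.
have mF : measurable_fun setT F.
  apply/measurable_EFinP.
  exact: (measurableT_comp (mprod n.+1 x) (@measurable_tuple_cons R n)).
rewrite (fubini_tonelli1 F)//.
pose x' := [tuple of behead x].
have xE i : tnth x (lift ord0 i) = tnth x' i by rewrite !(tnth_nth 0)/= nth_behead.
have E1 u : (fubini_F (uniform_cube R n) F u <=
    (phi (tnth x ord0 - u))%:E * (M ^+ n)%:E)%E.
  rewrite [leLHS](_ : fubini_F _ _ _ = \int[uniform_cube R n]_y
      ((phi (tnth x ord0 - u))%:E * (\prod_(i < n) phi (tnth x' i - tnth y i))%:E))%E; last first.
    apply: eq_integral => y _; rewrite /F big_ord_recl EFinM; congr (_ * _%:E)%E.
    by apply: eq_bigr => i _; rewrite xE tnthS.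
  rewrite ge0_integralZl//.
  - by rewrite lee_wpmul2l ?lee_fin.
  - by apply/measurable_EFinP; exact: mprod.
  - by move=> y _; rewrite lee_fin; exact: prod0.
  - by rewrite lee_fin.
apply: (@le_trans _ _ (\int[uniform_prob (@ltr01 R)]_u
    ((phi (tnth x ord0 - u))%:E * (M ^+ n)%:E))%E).
  apply: ge0_le_integral => //.
  - by move=> u _; apply: integral_ge0.
  - exact: measurable_fun_fubini_tonelli_F.
  - apply: emeasurable_funM => //; apply/measurable_EFinP/measurableT_comp => //.
    exact: measurable_funB.
rewrite ge0_integralZr ?lee_fin ?exprn_ge0//.
- by rewrite exprS EFinM lee_wpmul2r ?lee_fin ?exprn_ge0.
- apply/measurable_EFinP/measurableT_comp => //; exact: measurable_funB.
- by move=> u _; rewrite lee_fin.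
Qed.

End cube_integrals.

(** * One-dimensional kernel estimates *)

Lemma integral_expR_affine (R : realType) (r t a b : R) : r != 0 -> a < b ->
  (\int[lebesgue_measure]_(u in `[a, b]) (expR (r * (u - t)))%:E =
   ((expR (r * (b - t)) - expR (r * (a - t))) / r)%:E)%E.
Proof.
move=> r0 ab; pose F u := expR (r * (u - t)) / r.
have dlin (u : R) : is_derive u 1 (fun u => r * (u - t)) r.
  have : is_derive u 1 (r \*: (id - cst t)) (r *: (1 - 0)).
    by apply: is_deriveZ; apply: is_deriveB.
  by rewrite subr0 /GRing.scale/= mulr1.
have dE (u : R) : is_derive u 1 (fun u => expR (r * (u - t))) (expR (r * (u - t)) * r).
  exact: (@is_derive1_comp R expR (fun u => r * (u - t)) u _ _
    (is_derive_expR _) (dlin u)).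
have dF (u : R) : is_derive u 1 F (expR (r * (u - t))).
  have : is_derive u 1 (r^-1 \*: (fun u => expR (r * (u - t))))
      (r^-1 *: (expR (r * (u - t)) * r)).
    exact: is_deriveZ.
  rewrite [_ *: (_ * _)](_ : _ = expR (r * (u - t)));
    last by rewrite /GRing.scale/= mulrC mulfK.
  move=> dF; rewrite (_ : F = r^-1 \*: (fun u => expR (r * (u - t))))//.
  by apply/funext => v; rewrite /F mulrC.
have cE (u : R) : {for u, continuous (fun u => expR (r * (u - t)))}.
  by apply: differentiable_continuous; apply/derivable1_diffP; exact: ex_derive.
have cF (u : R) : {for u, continuous F}.
  by apply: differentiable_continuous; apply/derivable1_diffP; exact: ex_derive.
rewrite (@continuous_FTC2 _ _ F)//.
- by rewrite -EFinB mulrBl.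
- exact: continuous_subspaceT.
- split.
  + by move=> u _; exact: ex_derive.
  + exact/cvg_at_right_filter/cF.
  + exact/cvg_at_left_filter/cF.
- by move=> u _; rewrite derive1E derive_val.
Qed.

(** The uniform density is the indicator of [[0, 1]], and each side of the kink at [u = t]
    contributes at most [e]. *)
Lemma integral_uniform_expR_le (R : realType) (e t : R) : 0 < e ->
  (\int[uniform_prob (@ltr01 R)]_u (expR (- `|t - u| / e))%:E <= (2 * e)%:E)%E.
Proof.
move=> e0.
have mE : measurable_fun setT (fun u : R => expR (- `|t - u| / e)).
  apply: measurableT_comp => //; apply: measurable_funM => //.
  apply: measurableT_comp => //; apply: measurableT_comp => //.
  exact: measurable_funB.
have E0 (u : R) : (0 <= (expR (- `|t - u| / e))%:E)%E by rewrite lee_fin expR_ge0.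
rewrite integral_uniform//; last exact/measurable_EFinP.
rewrite subr0 invr1 mul1e.
(* The interval of radius [|t| + 1] about [t] contains [[0, 1]] and has [t] in its interior, so it
   can be split at [t] even when [t] lies outside [[0, 1]]. *)
have L0 : 0 < `|t| + 1 by rewrite ltr_wpDl.
have tL : t < t + (`|t| + 1) by rewrite ltrDl.
have Lt : t - (`|t| + 1) < t by rewrite ltrBlDr ltrDl.
apply: (@le_trans _ _ (\int[lebesgue_measure]_(u in
    `[(t - (`|t| + 1))%R, (t + (`|t| + 1))%R]) (expR (- `|t - u| / e))%:E)%E).
  apply: ge0_subset_integral => //; first exact/measurable_EFinP/measurable_funTS.
  move=> u /=; rewrite !in_itv/= => /andP[u0 u1].
  by have := ler_norm t; have := ler_norm (- t); rewrite normrN; lra.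
rewrite (@itv_bndbnd_setU _ _ _ (BLeft t)) ?bnd_simp ?(ltW tL) ?(ltW Lt)//.
rewrite ge0_integral_setU//=; last 2 first.
- exact/measurable_EFinP/measurable_funTS.
- apply/disj_setPRL => u /=; rewrite !in_itv/= => /andP[tu _].
  by rewrite ltNge tu andbF.
rewrite integral_itv_bndo_bndc; last exact/measurable_EFinP/measurable_funTS.
have e1 : e^-1 != 0 by rewrite invr_neq0// gt_eqF.
under eq_integral => u.
  rewrite inE/= in_itv/= => /andP[_ ut].
  rewrite ger0_norm ?subr_ge0// opprB mulrC; over.
rewrite integral_expR_affine//.
under eq_integral => u.
  rewrite inE/= in_itv/= => /andP[tu _].
  rewrite ler0_norm ?subr_le0// opprK mulrC -[t - u]opprB mulrN -mulNr; over.
rewrite integral_expR_affine ?oppr_eq0//.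
rewrite -EFinD lee_fin subrr !mulr0 expR0 invrN invrK.
set p := expR _; set q := expR _.
have p0 : 0 < p by exact: expR_gt0.
have q0 : 0 < q by exact: expR_gt0.
nra.
Qed.

Lemma integral_uniform_indic_le (R : realType) (a t : R) : 0 <= a ->
  (\int[uniform_prob (@ltr01 R)]_u (\1_(`[- a, a]%classic) (t - u))%:E <= (2 * a)%:E)%E.
Proof.
move=> a0.
have E u : \1_(`[- a, a]%classic) (t - u) = \1_(`[(t - a)%R, (t + a)%R]%classic) u :> R.
  rewrite !indicE (_ : (_ \in _) = (u \in `[(t - a)%R, (t + a)%R]%classic))//.
  apply/idP/idP; rewrite !inE/= !in_itv/= => /andP[? ?]; apply/andP; split; lra.
under eq_integral do rewrite E.
rewrite integral_uniform//; last exact/measurable_EFinP/measurable_indic.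
rewrite subr0 invr1 mul1e.
apply: (@le_trans _ _ (\int[lebesgue_measure]_u
    (\1_(`[(t - a)%R, (t + a)%R]%classic) u)%:E)%E).
  by apply: ge0_subset_integral => //; exact/measurable_EFinP/measurable_indic.
rewrite integral_indic// setIT.
rewrite [leLHS](_ : _ = lebesgue_measure `[(t - a)%R, (t + a)%R]%classic)//.
rewrite lebesgue_measure_itv/= lte_fin.
by case: ifPn => _; rewrite -?EFinB lee_fin; lra.
Qed.

(** * The two transport problems for the l1 cost *)

Definition diagonal d (T : measurableType d) (x : T) : T * T := (x, x).

Lemma measurable_diagonal d (T : measurableType d) :
  measurable_fun setT (@diagonal d T).
Proof. exact: measurable_fun_pair. Qed.

HB.instance Definition _ d (T : measurableType d) :=
  isMeasurableFun.Build _ _ _ _ (@diagonal d T) (@measurable_diagonal d T).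

Lemma measurable_l1_cost (R : realType) n : measurable_fun setT (@l1_cost R n).
Proof.
apply: measurable_sum => i; apply: measurableT_comp => //; apply: measurable_funB.
- exact: (measurableT_comp (measurable_tnth i) measurable_fst).
- exact: (measurableT_comp (measurable_tnth i) measurable_snd).
Qed.

Lemma l1_cost_ge0 (R : realType) n z : 0 <= @l1_cost R n z.
Proof. exact: sumr_ge0. Qed.

Lemma OT_l1_cost_diag (R : realType) n
    (mu : probability (n.-tuple (measurableTypeR R)) R) :
  OT mu mu (@l1_cost R n) = 0%E.
Proof.
apply/eqP; rewrite eq_le; apply/andP; split; last first.
  apply: le_ereal_inf_tmp => _ [pi _ <-]; apply: integral_ge0 => z _.
  by rewrite lee_fin l1_cost_ge0.
apply: ereal_inf_lbound; exists (distribution mu (@diagonal _ _)).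
  split => A mA; rewrite /= /distribution /pushforward; congr (mu _).
  - by apply/seteqP; split => x // -[].
  - by apply/seteqP; split => x // -[].
rewrite ge0_integral_distribution//.
- apply: integral0_eq => x _; rewrite /= /l1_cost big1// => i _.
  by rewrite subrr normr0.
- apply/measurable_EFinP; exact: measurable_l1_cost.
- by move=> z; rewrite lee_fin l1_cost_ge0.
Qed.

(** Both divergences admit a dual function that is a constant plus a product kernel: [phi] is
    exponential for the entropy and an indicator for the power. Integrating that function gives at
    most [b + G * M ^+ n]. *)
Lemma regularized_OT_uniform_cube_ge (R : realType) n (phi f : R -> R)
    (a b G M S e : R) :
  measurable_fun setT phi -> (forall t, 0 <= phi t) ->
  (forall t, \int[uniform_prob (@ltr01 R)]_u (phi (t - u))%:E <= M%:E)%E ->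
  measurable_fun setT f -> (forall w, 0 <= w -> - S <= f w) ->
  0 < e -> 0 <= b -> 0 <= G ->
  (forall (z : n.-tuple (measurableTypeR R) * n.-tuple (measurableTypeR R)) w, 0 <= w ->
     a * w - (b + G * \prod_(i < n) phi (tnth z.1 i - tnth z.2 i)) <=
     l1_cost z * w + e * f w) ->
  ((a - (b + G * M ^+ n))%:E <=
    regularized_OT (uniform_cube R n) (uniform_cube R n) (@l1_cost R n) f e)%E.
Proof.
move=> mphi phi0 phiM mf fS e0 b0 G0 dual.
apply: le_ereal_inf_tmp => _ [pi _ <-].
have mprod := measurable_prod_tnth_sub _ _ n mphi.
have prod0 (z : n.-tuple (measurableTypeR R) * n.-tuple (measurableTypeR R)) :
  0 <= \prod_(i < n) phi (tnth z.1 i - tnth z.2 i) by apply: prodr_ge0.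
apply: fdiv_duality dual _ => //.
- exact: measurable_l1_cost.
- exact: l1_cost_ge0.
- by apply: measurable_funD => //; exact: measurable_funM.
- by move=> z; rewrite addr_ge0 ?mulr_ge0.
- exact: fS.
under eq_integral do rewrite EFinD EFinM.
rewrite ge0_integralD//=; last 2 first.
- by move=> z _; rewrite mule_ge0 ?lee_fin.
- by apply: emeasurable_funM => //; exact/measurable_EFinP.
rewrite probability_integral_cst ge0_integralZl//=; last 2 first.
- exact/measurable_EFinP.
- by move=> z _; rewrite lee_fin.
rewrite EFinD EFinM leeD2l// lee_wpmul2l ?lee_fin//.
rewrite fubini_tonelli1//=; last exact/measurable_EFinP.
apply: (@le_trans _ _ (\int[uniform_cube R n]_x (M ^+ n)%:E)%E).
  apply: ge0_le_integral => //.
  - by move=> x _; apply: integral_ge0 => y _; rewrite lee_fin; exact: (prod0 (x, y)).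
  - apply: measurable_fun_fubini_tonelli_F; first exact/measurable_EFinP.
    by move=> z; rewrite lee_fin.
  - by move=> x _; rewrite /fubini_F/=; exact: uniform_cube_prod_le.
by rewrite probability_integral_cst.
Qed.

(** * Entropic regularization *)

(** Fenchel-Young, [expR (t - 1)] being the conjugate of [w * ln w]. It is [expR s >= 1 + s] at
    [s = t - 1 - ln w], multiplied by [w]. *)
Lemma mul_ln_ge_tangent (R : realType) (w t : R) : 0 <= w ->
  w * t - expR (t - 1) <= w * ln w.
Proof.
rewrite le_eqVlt => /predU1P[<-|w0].
  by rewrite !mul0r sub0r oppr_le0 expR_ge0.
have := expR_ge1Dx (t - 1 - ln w); rewrite expRD expRN lnK ?posrE//.
rewrite ler_pdivlMr// => h.
nra.
Qed.

Lemma entropic_OT_ge (R : realType) (d : nat) (e : R) : 0 < e ->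
  ((d%:R * e * ln (1 / e) - (2 ^+ d - 1) * e)%R%:E <=
   regularized_OT (uniform_cube R d) (uniform_cube R d) (@l1_cost R d)
     (fun x : R => x * ln x)%R e)%E.
Proof.
move=> e0; pose a := d%:R * ln (1 / e).
have -> : d%:R * e * ln (1 / e) - (2 ^+ d - 1) * e =
    e * (1 + a) - (0 + e * expR a * (2 * e) ^+ d).
  rewrite /a expRM_natl lnK ?posrE ?divr_gt0// mul1r exprVn exprMn.
  rewrite add0r -[e * _ * _]mulrA [_^-1 * _]mulrC mulfK ?expf_neq0 ?gt_eqF//.
  ring.
apply: (@regularized_OT_uniform_cube_ge _ _
  (fun u => expR (- `|u| / e)) _ _ _ _ _ 1) => //.
- apply: measurableT_comp => //; apply: measurable_funM => //.
  by apply: measurableT_comp => //; exact: measurableT_comp.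
- by move=> t; exact: integral_uniform_expR_le.
- by apply: measurable_funM => //; exact: measurable_ln.
- move=> w w0; have := mul_ln_ge_tangent _ _ 0 w0.
  have := mul_ln_ge_tangent _ _ 1 w0; rewrite subrr expR0; lra.
- by rewrite mulr_ge0 ?expR_ge0 ?ltW.
move=> z w w0; rewrite -expR_sum -mulr_suml sumrN -/(l1_cost z) add0r.
(* The slope is the level minus the cost, divided by [e]; shifted by 1, its exponential factors into
   [expR a] and the product kernel. *)
have := mul_ln_ge_tangent _ _ (1 + a - l1_cost z / e) w0.
rewrite (_ : _ - 1 = a + - l1_cost z / e) ?expRD; last by rewrite mulNr; ring.
set c := l1_cost z; set x := expR _; set y := expR _ => h.
have := ler_wpM2l (ltW e0) h.
have -> : e * (w * (1 + a - c / e) - x * y) = e * (1 + a) * w - e * x * y - c * w.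
  by field; rewrite gt_eqF.
lra.
Qed.

(** * Power divergences *)

(** With [q] the exponent conjugate to [rho], [f^* t] is [t ^ q / q + 1 / rho] for [t >= 0] and
    [1 / rho] for [t < 0]. Bounding it on [{c <= a}] by its value at [a / e] gives the constant
    [e / rho] plus [G] times an indicator. *)
Lemma power_OT_ge (R : realType) (d : nat) (rho e : R) : 1 < rho -> 0 < e ->
  ((1 / (2 * rho) * e `^ (1 / ((rho - 1) * d%:R + 1)) - e / rho)%R%:E <=
   regularized_OT (uniform_cube R d) (uniform_cube R d) (@l1_cost R d)
     (fun x : R => 1 / rho * (x `^ rho - 1))%R e)%E.
Proof.
move=> rho1 e0; set s := (X in e `^ X).
pose q := rho / (rho - 1); pose a := e `^ s / 2.
have rho0 : 0 < rho by lra.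
have rho10 : 0 < rho - 1 by lra.
have q1 : 1 < q by rewrite /q ltr_pdivlMr//; lra.
have q0 : 0 < q by lra.
have pq : rho^-1 + q^-1 = 1 by rewrite /q; field; rewrite !gt_eqF.
have es0 : 0 < e `^ s by exact: powR_gt0.
have a0 : 0 < a by rewrite divr_gt0.
have D0 : 0 < (rho - 1) * d%:R + 1 by rewrite ltr_wpDl// mulr_ge0// ltW.
have ae0 : 0 <= a / e by rewrite ltW// divr_gt0.
pose G := e * ((a / e) `^ q / q).
have G0 : 0 <= G by rewrite mulr_ge0 ?divr_ge0 ?powR_ge0 ?ltW.
(* The choice of [s] solves [s = 1 + s * d + (s - 1) * q]. As [q > 1], the factor [(1 / 2) ^ q] is
   at most [1 / 2], so the bound is [a / q]. *)
have bound : G * (2 * a) ^+ d <= e `^ s / 2 / q.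
  rewrite /G mulrA mulrAC ler_pM2r ?invr_gt0//.
  have -> : 2 * a = e `^ s by rewrite /a mulrC divfK.
  have le2 : (a / e) `^ q <= 2^-1 * e `^ ((s - 1) * q).
    rewrite (powRrM e (s - 1) q) powRB ?(gt_eqF e0) ?implybT// powRr1 ?(ltW e0)//.
    rewrite /a mulrAC [_ / 2]mulrC; apply: ge1r_powRZ.
    - by apply/andP; split; lra.
    - by rewrite divr_ge0 ?ltW.
    - exact: ltW.
  rewrite -powR_mulrn ?powR_ge0// -powRrM.
  have -> : e `^ s = e * e `^ (s * d%:R) * e `^ ((s - 1) * q).
    rewrite -{2}(powRr1 (ltW e0)) -!powRD ?(gt_eqF e0) ?implybT//; congr (_ `^ _).
    by rewrite /s /q; field; rewrite !gt_eqF.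
  rewrite mulrAC -[leRHS]mulrA ler_wpM2l ?mulr_ge0 ?powR_ge0 ?(ltW e0)//.
  by rewrite [leRHS]mulrC.
apply: (@le_trans _ _ (a - (e / rho + G * (2 * a) ^+ d))%:E).
  rewrite lee_fin; apply: (@le_trans _ _ (a - (e / rho + e `^ s / 2 / q))); last first.
    by rewrite lerD2l lerN2 lerD2l.
  (* What remains of the level is [a - a / q = a / rho], whence the constant [1 / (2 * rho)]. *)
  have -> : q^-1 = 1 - rho^-1 by lra.
  rewrite /a le_eqVlt; apply/orP; left; apply/eqP; field; exact: lt0r_neq0.
apply: (@regularized_OT_uniform_cube_ge _ _
  (\1_(`[- a, a]%classic)) _ _ _ _ _ rho^-1) => //.
- by move=> t; exact: integral_uniform_indic_le (ltW a0).
- apply: measurable_funM => //; apply: measurable_funB => //; exact: measurable_powR.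
- by move=> w _; rewrite mul1r mulrBr mulr1 lerDr mulr_ge0 ?invr_ge0 ?powR_ge0 ?ltW.
- by rewrite divr_ge0 ?ltW.
move=> z w w0.
have -> : e * (1 / rho * (w `^ rho - 1)) = e * (w `^ rho / rho) - e / rho.
  by field; rewrite gt_eqF.
have wr0 : 0 <= e * (w `^ rho / rho) by rewrite mulr_ge0 ?divr_ge0 ?powR_ge0 ?ltW.
have P0 : 0 <= \prod_(i < d) \1_(`[- a, a]%classic) (tnth z.1 i - tnth z.2 i) :> R.
  by apply: prodr_ge0 => i _; rewrite indicE.
have c0 := l1_cost_ge0 _ _ z.
(* Above the level, [a * w <= c * w] and [f >= - 1 / rho] suffice. Below it every [|x_i - y_i|] is
   at most [a], so the product of indicators is 1 and Young's inequality for [w] and [a / e]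
   applies. *)
have [ca|ac] := leP (l1_cost z) a; last first.
  have := mulr_ge0 G0 P0; have := ler_wpM2r w0 (ltW ac); lra.
rewrite big1 ?mulr1; last first.
  move=> i _; rewrite indicE mem_set//= in_itv/= -ler_norml.
  apply: le_trans ca; rewrite /l1_cost (bigD1 i)//= lerDl; exact: sumr_ge0.
have := conjugate_powR w0 ae0 rho0 q0 pq => /(ler_wpM2l (ltW e0)).
have -> : e * (w * (a / e)) = a * w by field; rewrite gt_eqF.
rewrite mulrDr -/G; have := mulr_ge0 c0 w0; lra.
Qed.

Theorem proposition4p2 (R : realType) (d : nat) :
  let mu := uniform_cube R d in
  let c := @l1_cost R d in
  (let f := fun x : R => x * ln x in
   forall e : R, 0 < e ->
     ((d%:R * e * ln (1 / e) - (2 ^+ d - 1) * e)%R%:E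
        <= regularized_OT mu mu c f e - OT mu mu c)%E)
  /\
  (forall rho : R, 1 < rho ->
   let f := fun x : R => 1 / rho * (x `^ rho - 1) in
   exists2 K : R, 0 < K &
   exists2 g : R -> R, g =O_ (0^'+) (fun e : R => e) &
     \forall e \near 0^'+,
       ((K * e `^ (1 / ((rho - 1) * d%:R + 1)) + g e)%R%:E
          <= regularized_OT mu mu c f e - OT mu mu c)%E).
Proof.
move=> mu c; rewrite /c OT_l1_cost_diag; split=> [e e0|rho rho1].
  by rewrite sube0; exact: entropic_OT_ge.
exists (1 / (2 * rho)); first by rewrite divr_gt0// mulr_gt0//; lra.
exists (fun e => - (e / rho)).
  apply/eqO_exP; exists rho^-1; first by rewrite invr_gt0; lra.
  apply: nearW => e; rewrite normrN normrM mulrC ler_wpM2r//.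
  by rewrite ger0_norm// invr_ge0; lra.
near=> e; rewrite sube0; apply: power_OT_ge => //.
Unshelve. all: by end_near. Qed.
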